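(* (GBC) The principle $\mathrm{ETR}_{\mathrm{Ord}}$ implies the principle of determinacy for clopen class games of rank at most $\mathrm{Ord}+1$. More generally, for any class well-order $\Gamma$, the principle $\mathrm{ETR}_\Gamma$ implies determinacy for clopen class games of rank at most $\Gamma+1$.
   Context: $\mathrm{ETR}_\Gamma$ (for a class well-order $\Gamma$; $\mathrm{ETR}_{\mathrm{Ord}}$ is the case $\Gamma=\mathrm{Ord}$): for every first-order formula $\varphi(x,\alpha,X,A)$ and class $A$ there is a class $S\subseteq\Gamma\times V$ with $S_\alpha=\{x:\varphi(x,\alpha,S\restriction\alpha,A)\}$ for all $\alpha$ in $\Gamma$, where $S_\alpha=\{x:\langle\alpha,x\rangle\in S\}$ and $S\restriction\alpha=\{\langle\beta,x\rangle\in S:\beta<_\Gamma\alpha\}$. A clopen class game is played on a well-founded class tree $T\subseteq V^{<\omega}$ whose terminal nodes are labeled as a win for player I or player II: starting at the root, the players alternately choose a child of the current node until a terminal node is reached, whose label determines the winner. The tree has rank at most $\Gamma+1$ if the root can be labeled $\Gamma$ and every other node labeled with an element of $\Gamma$ so that each child has strictly smaller label than its parent (with rank at most $\mathrm{Ord}+1$ the case $\Gamma=\mathrm{Ord}$). A winning strategy for a player selects, for each node at which that player moves, a child, such that every play conforming to these choices ends at a terminal node labeled a win for that player. Determinacy: one of the players has a winning strategy. *)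

(* Defs.v *)
From mathcomp Require Import all_boot.

Set Implicit Arguments.
Unset Strict Implicit.
Unset Printing Implicit Defensive.

(** * First-order formulas of the language of classes

[fml k n] is the type of formulas with [n] free set variables (de Bruijn
indices, [ord0] being the most recently bound one) and [k] free class
variables.  Only set variables are quantified: this is what "first-order"
means in second-order set theory. *)

Inductive fml (k : nat) : nat -> Type :=
| fEq n (i j : 'I_n) : fml k n
| fMem n (i j : 'I_n) : fml k n
| fCls n (i : 'I_n) (c : 'I_k) : fml k n
| fBot n : fml k n
| fImp n (phi psi : fml k n) : fml k n
| fAll n (phi : fml k n.+1) : fml k n.

(** Two-sorted structures: sets, classes, membership between sets, and
membership of sets in classes.  A class [A] coerces to the predicate
"[x] is a member of [A]". *)

Record structure := Structure {
  V : Type;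
  class : Type;
  mem_set : V -> V -> Prop;
  mem_class : class -> V -> Prop
}.
Coercion mem_class : class >-> Funclass.

Notation "x ∈ y" := (mem_set x y) (at level 70, no associativity).

Definition scons (T : Type) n (x : T) (e : 'I_n -> T) : 'I_n.+1 -> T :=
  fun i => if unlift ord0 i is Some j then e j else x.

(** Class variables are interpreted by arbitrary predicates, so that a formula
can be evaluated at a class given by a description such as the restriction
[S|alpha] below; set variables range over all of [V M]. *)

Fixpoint sat (M : structure) k (E : 'I_k -> V M -> Prop) n (phi : fml k n) :
    ('I_n -> V M) -> Prop :=
  match phi in fml _ n return ('I_n -> V M) -> Prop with
  | fEq _ i j => fun e => e i = e j
  | fMem _ i j => fun e => e i ∈ e j
  | fCls _ i c => fun e => E c (e i)
  | fBot _ => fun _ => False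
  | fImp _ phi psi => fun e => sat E phi e -> sat E psi e
  | fAll _ phi => fun e => forall x, sat E phi (scons x e)
  end.

Section InternalNotions.
Variable M : structure.
Implicit Types (x y z a e f n p s t w : V M) (P : V M -> Prop).

Definition empty x := forall y, ~ y ∈ x.
Definition incl x y := forall z, z ∈ x -> z ∈ y.
Definition is_upair z x y := forall w, w ∈ z <-> w = x \/ w = y.

(** [z] is the Kuratowski pair of [x] and [y]. *)
Definition is_pair z x y :=
  exists u v, [/\ is_upair u x x, is_upair v x y & is_upair z u v].

(** The pair of [x] and [y] satisfies [P]; for a class [R] this is [x R y]. *)
Definition rel_of P x y := exists2 z, is_pair z x y & P z.

Definition functional P :=
  forall x y z, rel_of P x y -> rel_of P x z -> y = z.

Definition is_succ y x := forall w, w ∈ y <-> w ∈ x \/ w = x.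

Definition inductive a :=
  (exists2 z, empty z & z ∈ a) /\
  (forall x y, x ∈ a -> is_succ y x -> y ∈ a).

(** Natural numbers in the sense of [M], which may be nonstandard. *)
Definition is_nat n := forall a, inductive a -> n ∈ a.

Definition is_omega w := forall n, n ∈ w <-> is_nat n.

Definition is_fun f d :=
  (forall z, z ∈ f -> exists x y, x ∈ d /\ is_pair z x y) /\
  (forall x, x ∈ d -> exists! y, rel_of (fun z => z ∈ f) x y).

(** [D] is a predicate on sets and [lt] a strict order on it; minimality is
required of subclasses, which for a set [D] are the same as subsets. *)
Definition wellorder (D : V M -> Prop) (lt : V M -> V M -> Prop) :=
  [/\ forall x, D x -> ~ lt x x,
      forall x y z, D x -> D y -> D z -> lt x y -> lt y z -> lt x z,
      forall x y, D x -> D y -> [\/ lt x y, x = y | lt y x] &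
      forall B : class M, (exists x, B x) -> (forall x, B x -> D x) ->
        exists2 m, B m & forall y, B y -> ~ lt y m].

Definition is_ordinal a :=
  (forall x, x ∈ a -> incl x a) /\
  wellorder (fun x => x ∈ a) (@mem_set M).

End InternalNotions.

(** Gödel-Bernays set theory with global choice, the latter in the form of a
class well-order of the universe.  Separation is subsumed by replacement,
where the class function may be partial. *)

Record GBC (M : structure) : Prop := {
  set_extensionality : forall a b : V M,
    (forall x, x ∈ a <-> x ∈ b) -> a = b;
  class_extensionality : forall A B : class M,
    (forall x, A x <-> B x) -> A = B;
  foundation : forall a : V M, (exists x, x ∈ a) ->
    exists2 x, x ∈ a & forall y, y ∈ x -> ~ y ∈ a;
  pairing : forall x y : V M, exists z, is_upair z x y;
  union_set : forall a : V M, exists u, forall x,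
    x ∈ u <-> exists2 y, y ∈ a & x ∈ y;
  power_set : forall a : V M, exists b, forall x, x ∈ b <-> incl x a;
  infinity_set : exists a : V M, inductive a;
  comprehension : forall k n (phi : fml k n.+1)
      (E : 'I_k -> class M) (e : 'I_n -> V M),
    exists A : class M, forall x, A x <-> sat (fun c => E c) phi (scons x e);
  replacement : forall F : class M, functional F ->
    forall a, exists b, forall y, y ∈ b <-> exists2 x, x ∈ a & rel_of F x y;
  global_choice : exists R : class M, wellorder (fun _ => True) (rel_of R)
}.

(** * Elementary transfinite recursion

[G] is the field of the order and [lt] its strict order relation.  The free
variables of [phi] are [x], [alpha] (sets) and [X], [A] (classes). *)

Section Recursion.
Variables (M : structure) (G : V M -> Prop) (lt : V M -> V M -> Prop).

Definition restrict (S : class M) (alpha : V M) : V M -> Prop :=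
  fun z => S z /\ exists beta x, is_pair z beta x /\ lt beta alpha.

Definition ETR :=
  forall (phi : fml 2 2) (A : class M),
  exists S : class M,
    (forall z, S z -> exists alpha x, G alpha /\ is_pair z alpha x) /\
    (forall alpha, G alpha -> forall x,
       rel_of S alpha x <->
       sat (tnth [tuple restrict S alpha; mem_class A]) phi
           (tnth [tuple x; alpha])).

End Recursion.

Inductive player := PlayerI | PlayerII.

Section Games.
Variable M : structure.
Implicit Types (T : class M) (W : player -> class M) (sigma : class M).
Implicit Types (s t p n : V M) (pl : player).

Definition fin_seq s n := is_nat n /\ is_fun s n.

(** The root is the empty sequence. *)
Definition is_tree T :=
  [/\ forall s, T s -> exists n, fin_seq s n,
      forall s t n, T s -> fin_seq t n -> incl t s -> T t &
      exists2 r, empty r & T r].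

Definition child T s t :=
  [/\ T s, T t & exists m n,
    [/\ fin_seq s m, fin_seq t n, is_succ n m & incl s t]].

Definition terminal T s := T s /\ forall t, ~ child T s t.

Definition well_founded_tree T :=
  forall B : class M, (exists s, B s) -> (forall s, B s -> T s) ->
  exists2 s, B s & forall t, B t -> incl s t -> t = s.

(** [W pl] collects the nodes labeled as a win for [pl]; its members that are
not terminal nodes play no role. *)
Definition clopen_game T W :=
  [/\ is_tree T, well_founded_tree T &
      forall t, terminal T t -> exists! pl, W pl t].

(** Evenness in the sense of [M]: the set [e] contains 0 and alternates
up to [n]. *)
Definition is_even n :=
  exists e, [/\ forall z, empty z -> z ∈ e,
    forall k k', k ∈ n -> is_succ k' k -> (k' ∈ e <-> ~ k ∈ e) &
    n ∈ e].

Definition to_move pl s :=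
  exists2 n, fin_seq s n &
    match pl with PlayerI => is_even n | PlayerII => ~ is_even n end.

Definition strategy T pl sigma :=
  forall s, T s -> ~ terminal T s -> to_move pl s ->
  exists2 t, child T s t & forall u, rel_of sigma s u <-> u = t.

Definition infinite_branch T p :=
  exists2 w, is_omega w & is_fun p w /\
    forall s n, fin_seq s n -> incl s p -> T s.

(** A play, identified with the sequence of moves made: it stops only at a
terminal node. *)
Definition play T p := terminal T p \/ infinite_branch T p.

Definition conforms T pl sigma p :=
  forall s t, child T s t -> incl t p -> to_move pl s -> rel_of sigma s t.

Definition winning_strategy T W pl sigma :=
  strategy T pl sigma /\
  forall p, play T p -> conforms T pl sigma p -> terminal T p /\ W pl p.

Definition determined T W :=
  exists pl sigma, winning_strategy T W pl sigma.

(** The root carries the label [G] itself, which lies above every element of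
[G]; hence only the labels of the other nodes are recorded, and the children
of the root are subject to no further constraint. *)
Definition rank_le_succ (G : V M -> Prop) (lt : V M -> V M -> Prop) T :=
  exists rho : class M,
    (forall s, T s -> ~ empty s ->
       exists2 a, G a & forall b, rel_of rho s b <-> b = a) /\
    (forall s t a b, ~ empty s -> child T s t ->
       rel_of rho s a -> rel_of rho t b -> lt b a).

Definition clopen_determinacy (G : V M -> Prop) (lt : V M -> V M -> Prop) :=
  forall T W, clopen_game T W -> rank_le_succ G lt T -> determined T W.

End Games.

(* Main.v *)
(** Transfinite recursion along the rank function labels every position other
than the root as won or not won by player I, a position being won if I moves
there and some child is won, or if II moves there and all children are won; one
further step handles the root.  Whoever wins the root moves forever inside the
positions won by that player, and well-foundedness ends the play.  The recursion
refers only to children, whose rank is smaller. *)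

From mathcomp Require Import all_boot.
From Stdlib Require Import Classical FunctionalExtensionality.
Require Import Defs.

Set Implicit Arguments.
Unset Strict Implicit.
Unset Printing Implicit Defensive.

(** * Closure of first-order definability under connectives and set quantifiers *)

Section Definability.
Variables (M : structure) (I : Type) (k : nat) (E : I -> 'I_k -> V M -> Prop).

(* The index [v] lets one formula serve several class environments at once. *)
Definition definable n (Q : I -> ('I_n -> V M) -> Prop) :=
  exists phi : fml k n, forall v e, sat (E v) phi e <-> Q v e.

Lemma scons0 n (x : V M) (e : 'I_n -> V M) : scons x e ord0 = x.
Proof. by rewrite /scons unlift_none. Qed.

Lemma sconsS n (x : V M) (e : 'I_n -> V M) i : scons x e (lift ord0 i) = e i.
Proof. by rewrite /scons liftK. Qed.

Lemma scons_lift n (x : V M) (e : 'I_n -> V M) :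
  (fun i => scons x e (lift ord0 i)) = e.
Proof. by apply: functional_extensionality => i; rewrite sconsS. Qed.

Lemma def_eq n i j : definable (fun _ (e : 'I_n -> V M) => e i = e j).
Proof. by exists (fEq k i j). Qed.

Lemma def_mem n i j : definable (fun _ (e : 'I_n -> V M) => e i ∈ e j).
Proof. by exists (fMem k i j). Qed.

Lemma def_cls c (P : I -> V M -> Prop) n i :
  (forall v, E v c = P v) -> definable (fun v (e : 'I_n -> V M) => P v (e i)).
Proof. by move=> EP; exists (fCls i c) => v e /=; rewrite EP. Qed.

Section Connectives.
Variables (n : nat) (P Q : I -> ('I_n -> V M) -> Prop).
Hypotheses (dP : definable P) (dQ : definable Q).

Lemma def_imp : definable (fun v e => P v e -> Q v e).
Proof.
have [[p hp] [q hq]] := (dP, dQ).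
by exists (fImp p q) => v e /=; rewrite hp hq.
Qed.

Lemma def_not : definable (fun v e => ~ P v e).
Proof. by have [p hp] := dP; exists (fImp p (fBot _ _)) => v e /=; rewrite hp. Qed.

Lemma def_or : definable (fun v e => P v e \/ Q v e).
Proof.
have [[p hp] [q hq]] := (dP, dQ).
exists (fImp (fImp p (fBot _ _)) q) => v e /=; rewrite hp hq.
by have := classic (P v e); tauto.
Qed.

Lemma def_and : definable (fun v e => P v e /\ Q v e).
Proof.
have [[p hp] [q hq]] := (dP, dQ).
exists (fImp (fImp p (fImp q (fBot _ _))) (fBot _ _)) => v e /=; rewrite hp hq.
by have := (classic (P v e), classic (Q v e)); tauto.
Qed.
End Connectives.

Lemma def_ext n (P Q : I -> ('I_n -> V M) -> Prop) :
  definable P -> (forall v e, P v e <-> Q v e) -> definable Q.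
Proof. by move=> [p hp] PQ; exists p => v e; rewrite hp. Qed.

Lemma def_iff n (P Q : I -> ('I_n -> V M) -> Prop) :
  definable P -> definable Q -> definable (fun v e => P v e <-> Q v e).
Proof. by move=> dP dQ; apply: def_and; apply: def_imp. Qed.

Lemma def_and3 n (P Q R : I -> ('I_n -> V M) -> Prop) :
  definable P -> definable Q -> definable R ->
  definable (fun v e => [/\ P v e, Q v e & R v e]).
Proof.
move=> dP dQ dR; apply: def_ext (def_and dP (def_and dQ dR)) _ => v e.
by split=> [[? []]|[]].
Qed.

Lemma def_and4 n (P Q R S : I -> ('I_n -> V M) -> Prop) :
  definable P -> definable Q -> definable R -> definable S ->
  definable (fun v e => [/\ P v e, Q v e, R v e & S v e]).
Proof.
move=> dP dQ dR dS; apply: def_ext (def_and dP (def_and3 dQ dR dS)) _ => v e.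
by split=> [[? []]|[]].
Qed.

Section Quantifiers.
Variables (n : nat) (P Q : I -> V M -> ('I_n -> V M) -> Prop).
(** The bound variable becomes entry 0 of the environment. Avoiding [scons] here leaves goals whose
    atoms again read entries of [e], so the same closure lemmas apply to them. *)
Let open (R : I -> V M -> ('I_n -> V M) -> Prop) :=
  fun v (e : 'I_n.+1 -> V M) => R v (e ord0) (fun i => e (lift ord0 i)).

Lemma def_all : definable (open P) -> definable (fun v e => forall x, P v x e).
Proof.
move=> [p hp]; exists (fAll p) => v e /=.
by split=> H x; have := H x; rewrite hp /open scons0 scons_lift.
Qed.

Lemma def_ex : definable (open P) -> definable (fun v e => exists x, P v x e).
Proof.
move=> /def_not[p hp]; exists (fImp (fAll p) (fBot _ _)) => v e /=.
split=> [H|[x Px] H]; last by have := H x; rewrite hp /open scons0 scons_lift.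
apply: NNPP => nP; apply: H => x.
by rewrite hp /open scons0 scons_lift => Px; apply: nP; exists x.
Qed.
End Quantifiers.

Lemma def_ex2 n (P Q : I -> V M -> ('I_n -> V M) -> Prop) :
  definable (fun v (e : 'I_n.+1 -> V M) =>
    P v (e ord0) (fun i => e (lift ord0 i)) /\
    Q v (e ord0) (fun i => e (lift ord0 i))) ->
  definable (fun v e => exists2 x, P v x e & Q v x e).
Proof.
move=> dPQ.
have := @def_ex _ (fun v x e => P v x e /\ Q v x e) dPQ.
by move=> /def_ext; apply=> v e; split=> [[x []]|[x]]; exists x.
Qed.

End Definability.

(** Here the index is the class environment itself. The recursion formula needs this uniformity,
    since it is evaluated at a different restriction of [S] at each stage. *)
Lemma def_var (M : structure) k n c i :
  definable (fun E : 'I_k -> V M -> Prop => E)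
            (fun E (e : 'I_n -> V M) => E c (e i)).
Proof. by exists (fCls i c). Qed.

Ltac def_class c :=
  match goal with
  | |- @definable _ _ ?k _ _ (fun _ e => mem_class ?C (e ?i)) =>
    exact (@def_cls _ _ _ _ (@Ordinal k c isT) (fun=> mem_class C) _ i
             (fun=> erefl _))
  end.

Ltac def_connective :=
  first
  [ apply: def_eq | apply: def_mem
  | apply: def_iff | apply: def_and | apply: def_or
  | apply: def_not | apply: def_and3 | apply: def_and4
  | apply: def_ex2 | apply: def_ex
  | apply: def_imp | apply: def_all
  | apply: def_var | def_class 0 | def_class 1 | def_class 2 ].

(** * Definability of pairs, finite sequences and parity *)

Section DefinableNotions.
Variables (M : structure) (I : Type) (k : nat) (E : I -> 'I_k -> V M -> Prop).
Variable n : nat.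

Lemma def_pair i j l :
  definable E (fun _ (e : 'I_n -> V M) => is_pair (e i) (e j) (e l)).
Proof. by rewrite /is_pair /is_upair; repeat def_connective. Qed.

Lemma def_fin_seq i j : definable E (fun _ (e : 'I_n -> V M) => fin_seq (e i) (e j)).
Proof.
rewrite /fin_seq /is_nat /inductive /is_succ /empty /is_fun /unique /rel_of.
by repeat first [apply: def_pair | def_connective; cbv beta].
Qed.

Lemma def_even i : definable E (fun _ (e : 'I_n -> V M) => is_even (e i)).
Proof.
by rewrite /is_even /is_succ /empty; repeat (def_connective; cbv beta).
Qed.
End DefinableNotions.

Ltac def_auto :=
  cbv beta iota delta [empty incl rel_of is_succ inductive is_nat is_fun unique
    child terminal to_move];
  repeat (first [ apply: def_pair | apply: def_fin_seq | apply: def_even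
                | def_connective ]; cbv beta).

(** * Comprehension, ordered pairs and separation *)

Section GB.
Variables (M : structure) (HM : GBC M).
Implicit Types (a c d f g m n p s t x y z : V M) (C D T : class M).

(** Comprehension without writing a formula: definability of [Q] is derived from its shape. The
    index type is [unit] because the class parameters are fixed. *)
Lemma compr1 k (E : 'I_k -> class M) (Q : V M -> V M -> Prop) a :
  definable (fun _ : unit => fun j => mem_class (E j))
    (fun _ (e : 'I_2 -> V M) => Q (e ord0) (e (lift ord0 ord0))) ->
  exists A : class M, forall x, A x <-> Q x a.
Proof.
move=> [phi hphi].
have [A hA] := comprehension HM phi E (fun=> a).
by exists A => x; rewrite hA (hphi tt) scons0 sconsS.
Qed.

Lemma compr k (E : 'I_k -> class M) (Q : V M -> Prop) :
  definable (fun _ : unit => fun j => mem_class (E j))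
    (fun _ (e : 'I_1 -> V M) => Q (e ord0)) ->
  exists A : class M, forall x, A x <-> Q x.
Proof.
move=> [phi hphi].
have [A hA] := comprehension HM phi E (tnth [tuple]).
by exists A => x; rewrite hA (hphi tt) scons0.
Qed.


Lemma upair_uniq z z' x y : is_upair z x y -> is_upair z' x y -> z = z'.
Proof. by move=> h h'; apply: (set_extensionality HM) => w; rewrite h h'. Qed.

Lemma upair_inj z x y y' : is_upair z x y -> is_upair z x y' -> y = y'.
Proof.
move=> h h'.
have [|yx] : y = x \/ y = y' by apply/h'/h; right.
  have : y' = x \/ y' = y by apply/h/h'; right.
  by case=> -> // ->.
by [].
Qed.

Lemma pair_ex x y : exists z, is_pair z x y.
Proof.
have [u hu] := pairing HM x x; have [v hv] := pairing HM x y.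
by have [z hz] := pairing HM u v; exists z, u, v.
Qed.

Lemma pair_uniq z z' x y : is_pair z x y -> is_pair z' x y -> z = z'.
Proof.
move=> [u [v [hu hv hz]]] [u' [v' [hu' hv' hz']]].
move: hz'; rewrite (upair_uniq hu' hu) (upair_uniq hv' hv).
exact: upair_uniq.
Qed.

Lemma pair_inj z x y x' y' : is_pair z x y -> is_pair z x' y' -> x = x' /\ y = y'.
Proof.
move=> [u [v [hu hv hz]]] [u' [v' [hu' hv' hz']]].
have ex : x = x'.
  have [uE|uE] : u = u' \/ u = v' by apply/hz'/hz; left.
    by have /hu' [] : x ∈ u' by rewrite -uE; apply/hu; left.
  have /hu[] : x' ∈ u by rewrite uE; apply/hv'; left.
    by [].
  by [].
subst x'; split=> //.
have eu := upair_uniq hu' hu; subst u'.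
have ev := upair_inj hz hz'; subst v'.
exact: upair_inj hv hv'.
Qed.

Lemma rel_of_pair (P : V M -> Prop) z x y : is_pair z x y -> rel_of P x y <-> P z.
Proof.
move=> hz; split=> [[z' hz']|Pz]; last by exists z.
by rewrite (pair_uniq hz' hz).
Qed.

(** Replacement is applied to the identity restricted to [C], a partial class function. *)
Lemma separation C a : exists b, forall x, x ∈ b <-> x ∈ a /\ C x.
Proof.
have [F hF] : exists F : class M, forall z, F z <-> exists2 x, C x & is_pair z x x.
  by apply: (compr (E := tnth [tuple C])); def_auto.
have Fxy x y : rel_of F x y <-> x = y /\ C x.
  split=> [[z zxy /hF[w Cw /(pair_inj zxy)[-> ->]]] //|[<- Cx]].
  by have [z hz] := pair_ex x x; exists z => //; apply/hF; exists x.
have Ffun : functional F by move=> x y z /Fxy[<- _] /Fxy[].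
have [b hb] := replacement HM Ffun a.
exists b => y; rewrite hb; split=> [[x xa /Fxy[<-]] //|[ya Cy]].
by exists y => //; apply/Fxy.
Qed.

(** Foundation applied to the singleton of [x]. *)
Lemma mem_irr x : ~ x ∈ x.
Proof.
move=> xx; have [s hs] := pairing HM x x.
have [|y /hs ys ymin] := foundation HM (a := s).
  by exists x; apply/hs; left.
have {}ys : y = x by case: ys.
by apply: (ymin x); [rewrite ys|apply/hs; left].
Qed.

Lemma union2 a b : exists u, forall x, x ∈ u <-> x ∈ a \/ x ∈ b.
Proof.
have [c hc] := pairing HM a b; have [u hu] := union_set HM c.
exists u => x; rewrite hu; split=> [[y /hc[]-> xy]|[xa|xb]]; [by left|by right| |].
  by exists a => //; apply/hc; left.
by exists b => //; apply/hc; right.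
Qed.

Lemma adjoin a y : exists u, forall x, x ∈ u <-> x ∈ a \/ x = y.
Proof.
have [s hs] := pairing HM y y; have [u hu] := union2 a s.
by exists u => x; rewrite hu hs; tauto.
Qed.

Lemma empty_uniq x y : empty x -> empty y -> x = y.
Proof. by move=> hx hy; apply: (set_extensionality HM) => z; split=> [/hx|/hy]. Qed.

(** * Natural numbers of the model *)

Lemma nat_succ m n : is_nat m -> is_succ n m -> is_nat n.
Proof. by move=> hm hn a ha; apply: (ha.2 _ _ (hm a ha) hn). Qed.

(** Since [is_nat] refers to inductive sets only, a set is needed: the naturals satisfying [P] are
    separated from some inductive set, and they form an inductive set themselves. *)
Lemma nat_ind (P : V M -> Prop) :
  (exists C : class M, forall n, C n <-> P n) ->
  (forall z, empty z -> P z) ->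
  (forall m n, is_nat m -> P m -> is_succ n m -> P n) ->
  forall n, is_nat n -> P n.
Proof.
move=> [C hC] P0 PS n hn.
have [N hN] : exists N : class M, forall x, N x <-> is_nat x.
  by apply: (compr (E := tnth [tuple])); def_auto.
have [w hw] := infinity_set HM.
have [b hb] := separation N w.
have [c hc] := separation C b.
suff /hn /hc[_ /hC] : inductive c by [].
split.
  have [z z0 zw] := hw.1; exists z => //; apply/hc; split; last exact/hC/P0.
  apply/hb; split=> //; apply/hN => a [[z' z'0 z'a] _].
  by rewrite (empty_uniq z0 z'0).
move=> x y /hc[/hb[xw /hN xn] /hC Px] xy; apply/hc; split.
  apply/hb; split; last by apply/hN; apply: nat_succ xy.
  exact: hw.2 xy.
exact/hC/(PS x).
Qed.

Lemma nat_trans n x : is_nat n -> x ∈ n -> incl x n.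
Proof.
move=> hn; move: x.
pattern n; apply: nat_ind n hn.
  by apply: (compr (E := tnth [tuple])); def_auto.
  by move=> z z0 x /z0.
move=> m n hm mtr hn x.
by move=> /hn[/mtr xm|->] w ?; apply/hn; left=> //; apply: xm.
Qed.

Lemma nat_incl n m : is_nat n -> is_nat m -> incl m n -> m = n \/ m ∈ n.
Proof.
move=> hn; move: m.
pattern n; apply: nat_ind n hn.
  by apply: (compr (E := tnth [tuple])); def_auto.
  by move=> z z0 m _ mz; left; apply: empty_uniq => // w /mz /z0.
move=> n n' hn IH hn' m hm mn.
(* If [n] belongs to [m], then by transitivity [m] contains all of the successor [n'] and equals it.
   Otherwise [m] is already included in [n] and the induction hypothesis applies. *)
have [nm|nm] := classic (n ∈ m).
  left; apply: (set_extensionality HM) => w; split=> [/mn //|/hn'[wn|-> //]].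
  exact: nat_trans nm _ wn.
right; apply/hn'.
suff /(IH m hm)[->|] : incl m n by [right|left].
by move=> w wm; have /hn'[//|wn] := mn w wm; rewrite wn in wm.
Qed.

(** * Functions and extension of finite sequences *)

Lemma fun_dom f d z x y : is_fun f d -> z ∈ f -> is_pair z x y -> x ∈ d.
Proof. by move=> [hf _] /hf[x' [y' [x'd hz]]] /pair_inj-/(_ _ _ hz)[->]. Qed.

Lemma fun_incl_dom f d g c : is_fun f d -> is_fun g c -> incl f g -> incl d c.
Proof.
move=> [_ hf] hg fg x /hf[y [[z hz zf] _]].
exact: fun_dom hg (fg z zf) hz.
Qed.

Lemma fun_dom_uniq f d c : is_fun f d -> is_fun f c -> d = c.
Proof.
move=> hd hc; apply: (set_extensionality HM) => x.
by split; [apply: fun_incl_dom hd hc _ _|apply: fun_incl_dom hc hd _ _].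
Qed.

Lemma fun_incl_eq f g d : is_fun f d -> is_fun g d -> incl f g -> f = g.
Proof.
move=> hf hg fg; apply: (set_extensionality HM) => z; split=> [/fg //|zg].
have [x [y [xd hz]]] := hg.1 z zg.
have [y' [[z' hz' z'f] _]] := hf.2 x xd.
have [y0 [_ y0uniq]] := hg.2 x xd.
have y'y : y' = y.
  by rewrite -(y0uniq y') ?(y0uniq y) //; [exists z|exists z' => //; apply: fg].
by rewrite (pair_uniq hz (z' := z')) // -y'y.
Qed.

(* [t] is the restriction of [p] to the successor of [m]. *)
Lemma fin_seq_extend s m p d :
  fin_seq s m -> is_fun p d -> incl s p -> m ∈ d ->
  exists t n, [/\ is_succ n m, fin_seq t n, incl s t & incl t p].
Proof.
move=> [mN sm] pd sp md.
have [y [[z zmy zp] yuniq]] := pd.2 m md.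
have [t ht] := adjoin s z; have [n hn] := adjoin m m.
have tp : incl t p by move=> w /ht[/sp //|->].
exists t, n; split=> //; first split.
- exact: nat_succ mN hn.
- split=> [w /ht[/sm.1[x [v [xm wxv]]]|->]|x /hn xn].
  + by exists x, v; split=> //; apply/hn; left.
  + by exists m, y; split=> //; apply/hn; right.
  have xd : x ∈ d.
    by case: xn => [xm|-> //]; apply: fun_incl_dom sm pd sp _ xm.
  have [v [xv vuniq]] := pd.2 x xd.
  exists v; split; last by move=> v' [w wxv' /tp wp]; apply: vuniq; exists w.
  case: xn => [/sm.2[v' [[w wxv' ws] _]]|xm].
    rewrite (vuniq v'); last by exists w => //; apply: sp.
    by exists w => //; apply/ht; left.
  rewrite xm in vuniq *; rewrite (vuniq y); last by exists z.
  by exists z => //; apply/ht; right.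
by move=> w ws; apply/ht; left.
Qed.

(** * Moves and plays in a game tree *)

Lemma child_of_nonterminal T s : T s -> ~ terminal T s -> exists t, child T s t.
Proof.
move=> Ts nt; apply: NNPP => nex; apply: nt; split=> // t st.
by apply: nex; exists t.
Qed.

(** Equality would identify the length [m] with its successor [n], making [m] an element of
    itself. *)
Lemma child_neq T s t : child T s t -> s <> t.
Proof.
move=> [_ _ [m [n [[_ sm] [_ tn] mn _]]]] st; rewrite -st in tn.
apply: (@mem_irr m); rewrite {2}(fun_dom_uniq sm tn).
by apply/mn; right.
Qed.

Lemma to_move_excl s : to_move PlayerI s -> ~ to_move PlayerII s.
Proof.
move=> [n [_ sn] ev] [m [_ sm]]; apply.
by rewrite (fun_dom_uniq sm sn).
Qed.

Lemma to_move_total T s :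
  is_tree T -> T s -> to_move PlayerI s \/ to_move PlayerII s.
Proof.
move=> [hT _ _] /hT[n sn].
by have [ev|ev] := classic (is_even n); [left|right]; exists n.
Qed.

(** The length [m] of [s] is compared with the domain of [p]. Equal lengths give [s = p]; otherwise
    [m] lies in the domain, automatically so when the domain is omega, and [s] extends by one entry
    of [p]. *)
Lemma play_child T p s : is_tree T -> play T p -> T s -> incl s p ->
  (terminal T p /\ s = p) \/ exists2 t, child T s t & incl t p.
Proof.
move=> [hfin hdown hroot] hp Ts sp; have [m sm] := hfin s Ts.
case: hp => [[Tp tp]|[w hw [pw pT]]].
  have [n pn] := hfin p Tp.
  have mn := fun_incl_dom sm.2 pn.2 sp.
  have [mEn|mIn] := nat_incl pn.1 sm.1 mn.
    left; split=> //; apply: fun_incl_eq sp; first exact: sm.2.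
    by rewrite mEn; exact: pn.2.
  right; have [t [n' [mn' tn' st tp']]] := fin_seq_extend sm pn.2 sp mIn.
  by exists t => //; split=> //; [apply: hdown tn' tp'|exists m, n'].
right; have mw : m ∈ w by apply/hw; exact: sm.1.
have [t [n' [mn' tn' st tp']]] := fin_seq_extend sm pw sp mw.
by exists t => //; split=> //; [apply: pT tn' tp'|exists m, n'].
Qed.

(* A player whose moves can always remain in [D], while the opponent's moves
cannot leave it, wins by staying in [D]: the longest initial segment of a play
lying in [D] exists since [T] is well-founded, and it has to be terminal. *)
Lemma winning_region T (W : player -> class M) pl D :
  clopen_game T W ->
  (exists2 r, empty r & D r) -> (forall s, D s -> T s) ->
  (forall s, D s -> terminal T s -> W pl s) ->
  (forall s, D s -> ~ terminal T s -> to_move pl s ->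
     exists2 t, child T s t & D t) ->
  (forall s t, D s -> ~ to_move pl s -> child T s t -> D t) ->
  exists sigma, winning_strategy T W pl sigma.
Proof.
move=> [treeT wfT _] [r r0 Dr] DT Dterm Dmove Dstay.
(* Where no child lies in [D] every child is good, because a strategy must answer at every
   nonterminal node where [pl] moves. *)
pose good s t := child T s t /\ ((exists2 u, child T s u & D u) -> D t).
have [R hR] := global_choice HM; have [Rirr _ Rtri Rmin] := hR.
(* Taking the [R]-least good child makes the choice single-valued and definable, so that it forms a
   class. *)
pose Q z := exists s t, is_pair z s t /\
  (good s t /\ forall u, good s u -> ~ rel_of R u t).
have [sigma hsigma] : exists sigma : class M, forall z, sigma z <-> Q z.
  by rewrite /Q /good; apply: (compr (E := tnth [tuple T; D; R])); def_auto.
have sigmaE s t : rel_of sigma s t <->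
    good s t /\ forall u, good s u -> ~ rel_of R u t.
  have [z hz] := pair_ex s t.
  rewrite (rel_of_pair _ hz) hsigma; split=> [|gst]; last by exists s, t.
  by move=> [s' [t' [/(pair_inj hz)[<- <-]]]].
exists sigma; split.
  move=> s Ts nts mv.
  have [G hG] : exists G : class M, forall t, G t <-> good s t.
    rewrite /good; apply: (compr1 (E := tnth [tuple T; D])
      (Q := fun t s => child T s t /\ ((exists2 u, child T s u & D u) -> D t))).
    by def_auto.
  have [||t /hG gt tmin] := Rmin G => //.
    have [[u su Du]|nex] := classic (exists2 u, child T s u & D u).
      by exists u; apply/hG.
    by have [u su] := child_of_nonterminal Ts nts; exists u; apply/hG.
  exists t; first exact: gt.1.
  move=> u; rewrite sigmaE; split=> [[gu umin]|->]; last first.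
    by split=> // v /hG /tmin.
  by case: (Rtri u t) => // [/tmin[]|/umin[]] //; apply/hG.
move=> p playp conf.
have [B hB] : exists B : class M, forall s, B s <-> D s /\ incl s p.
  apply: (compr1 (E := tnth [tuple D]) (Q := fun s p => D s /\ incl s p)).
  by def_auto.
have [||s /hB[Ds sp] smax] := wfT B.
- by exists r; apply/hB; split=> // z /r0.
- by move=> s /hB[/DT].
have Ts := DT s Ds.
have [[tp sEp]|[t st tp]] := play_child treeT playp Ts sp.
  by rewrite sEp in Ds; split=> //; apply: Dterm.
(* The next position [t] of the play would also be in [B], against the maximality of [s]. *)
case: (child_neq st); apply/esym/smax; last by case: st => _ _ [m [n []]].
apply/hB; split=> //.
have [mv|nmv] := classic (to_move pl s); last exact: Dstay st.
have /sigmaE[[_ gt] _] := conf s t st tp mv.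
by apply/gt/Dmove => // -[_ /(_ t)].
Qed.

(** * Determinacy from the recursion principle *)

Section Recursion.
(** Predicates rather than classes, so that the ordinals under membership and a class with a class
    relation are both direct instances. *)
Variables (G : V M -> Prop) (lt : V M -> V M -> Prop).
Hypothesis etr : ETR G lt.

Lemma etr_determined T W : clopen_game T W -> rank_le_succ G lt T -> determined T W.
Proof.
move=> game [rho [rho_fun rho_dec]]; have [treeT wfT labels] := game.
(* At a tagged position player I needs all children to be won, at an untagged one
some child; for terminal nodes this gives the label. *)
pose tag s := (terminal T s /\ W PlayerI s) \/
              (~ terminal T s /\ ~ to_move PlayerI s).
(* ETR admits a single class parameter, so [A] codes the tree, the ranks and the
tag at once: the tag of [s] is recorded as a loop at [s]. *)
pose Q z := exists a s t p, [/\ is_pair z a p, is_pair p s t, rel_of rho s a &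
  T s /\ (child T s t \/ (t = s /\ tag s))].
have [A hA] : exists A : class M, forall z, A z <-> Q z.
  rewrite /Q /tag; apply: (compr (E := tnth [tuple T; rho; W PlayerI])).
  by def_auto.
pose edge A a s t := exists z p, [/\ is_pair z a p, is_pair p s t & A z].
have edgeE a s t : edge A a s t <->
    rel_of rho s a /\ T s /\ (child T s t \/ (t = s /\ tag s)).
  split.
    move=> [z [p [hz hp /hA[a' [s' [t' [p' [hz' hp' h1 h2]]]]]]]].
    have [ea ep] := pair_inj hz hz'; subst a' p'.
    by have [es et] := pair_inj hp hp'; subst s' t'.
  move=> [h1 h2]; have [p hp] := pair_ex s t; have [z hz] := pair_ex a p.
  by exists z, p; split=> //; apply/hA; exists a, s, t, p.
pose below (X : V M -> Prop) t := exists b z, is_pair z b t /\ X z.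
(* The alternative [t = s] exempts the loop that encodes the tag; in the untagged case there is no
   loop to exempt. *)
pose step (X C : V M -> Prop) s a :=
  (edge C a s s /\ forall t, edge C a s t -> t = s \/ below X t) \/
  (~ edge C a s s /\ exists t, edge C a s t /\ below X t).
have [phi hphi] : definable (fun E : 'I_2 -> V M -> Prop => E)
   (fun E (e : 'I_2 -> V M) =>
      step (E ord0) (E ord_max) (e ord0) (e ord_max)).
  by rewrite /step /edge /below; def_auto.
have [S [Sdom hS]] := etr phi A.
have {}hS a s : G a -> rel_of S a s <-> step (restrict lt S a) A s a.
  by move=> Ga; rewrite hS // hphi.
(* The stage can be forgotten: the next claim shows that a node enters [S] only at a stage that
   [rho] assigns to it. *)
pose U t := exists b, rel_of S b t.
(* Both cases of [step] provide an edge leaving [t] at stage [b], and an edge records a rank of its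
   source. *)
have S_rho b t : rel_of S b t -> G b /\ rel_of rho t b.
  move=> [z hz Sz]; have [b' [t' [Gb hz']]] := Sdom z Sz.
  have [eb et] := pair_inj hz hz'; subst b' t'; split=> //.
  have [|[/edgeE[]]|[_ [u [/edgeE[]]]]] // := proj1 (hS b t Gb).
  by exists z.
have child_nonempty s t : child T s t -> ~ empty t.
  move=> st t0; apply: (child_neq st).
  by apply: empty_uniq => // z; case: st => _ _ [m [n [_ _ _ /(_ z) h]]] /h /t0.
have rho_uniq s a b : T s -> ~ empty s -> rel_of rho s a -> rel_of rho s b -> a = b.
  by move=> Ts /(rho_fun s Ts)[c _ hc] /hc -> /hc ->.
(* Ranks drop along children of nodes other than the root, so restricting to earlier stages loses no
   information about those children. *)
have belowE s t a : ~ empty s -> child T s t -> rel_of rho s a ->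
    below (restrict lt S a) t <-> U t.
  move=> s0 st sa; split.
    by move=> [b [z [hz [Sz _]]]]; exists b, z.
  move=> [b bt]; have [Gb tb] := S_rho b t bt.
  case: bt => z hz Sz; exists b, z; split=> //; split=> //.
  by exists b, t; split=> //; apply: (rho_dec s t).
pose win P s := (tag s /\ forall t, child T s t -> P t) \/
                (~ tag s /\ exists2 t, child T s t & P t).
have UE s : T s -> ~ empty s -> U s <-> win U s.
  move=> Ts s0; have [a Ga ha] := rho_fun s Ts s0.
  have sa : rel_of rho s a by apply/ha.
  have -> : U s <-> rel_of S a s.
    split=> [[b bs]|]; last by exists a.
    by rewrite (rho_uniq s a b Ts s0 sa) //; case: (S_rho b s bs).
  have tagE : edge A a s s <-> tag s.
    rewrite edgeE; split=> [[_ [_ [/child_neq|[]]]] //|]; by auto.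
  have childE t : child T s t -> edge A a s t by move=> st; apply/edgeE; auto.
  rewrite hS // /step /win tagE; split=> -[[tg H]|[tg H]].
  - left; split=> // t st; have [ts|] := H t (childE t st).
      by case: (child_neq st).
    by rewrite (belowE s).
  - right; split=> //; have [t [/edgeE[_ [_ [st|[_ /tg]]]] //]] := H.
    by rewrite (belowE s) // => Ut; exists t.
  - left; split=> // t /edgeE[_ [_ [st|[-> _]]]]; last by left.
    by right; apply/(belowE s) => //; apply: H.
  - right; split=> //; have [t st Ut] := H.
    by exists t; split; [apply: childE|apply/(belowE s)].
(* The rank hypothesis says nothing about [rho] at the root, so [U] is unreliable there. Applying
   [win] once more to [U] consults only children, which are never the root. *)
pose Win s := T s /\ win U s.
have [D hD] : exists D : class M, forall s, D s <-> Win s.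
  rewrite /Win /win /U /tag.
  by apply: (compr (E := tnth [tuple T; S; W PlayerI])); def_auto.
have [D' hD'] : exists D' : class M, forall s, D' s <-> T s /\ ~ D s.
  by apply: (compr (E := tnth [tuple T; D])); def_auto.
(* By [UE], [D] agrees with [U] on all children, so [D] solves the fixed-point equation at every
   node, root included. *)
have DE s : D s <-> T s /\ win D s.
  rewrite hD; split=> -[Ts]; rewrite /win => ws; split=> //.
    case: ws => -[tg H]; [left|right]; split=> //.
      move=> t st; apply/hD; have Tt : T t by case: st.
      by split=> //; apply/UE; [|exact: child_nonempty st|exact: H].
    case: H => t st Ut; exists t => //; apply/hD; have Tt : T t by case: st.
    by split=> //; apply/UE => //; exact: child_nonempty st.
  case: ws => -[tg H]; [left|right]; split=> //.
    move=> t st; have /hD[Tt wt] := H t st.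
    by apply/UE => //; exact: child_nonempty st.
  case: H => t st /hD[Tt wt]; exists t => //.
  by apply/UE => //; exact: child_nonempty st.
have [_ _ [r r0 Tr]] := treeT.
have [Dr|nDr] := classic (D r).
  exists PlayerI; apply: (winning_region (D := D)) => //.
  - by exists r.
  - by move=> s /DE[].
  (* Without children only the tagged case of [win] survives, and the tag of a terminal node is its
     label. *)
  - move=> s /DE[_ ws] ts; case: ws => [[[[]|[]] //]|[_ [t]]].
    by move/(proj2 ts).
  - move=> s /DE[Ts ws] nts mv; case: ws => [[[[]|[]] //]|[_ [t st Dt]]].
    by exists t.
  - move=> s t /DE[Ts ws] nmv st.
    have tg : tag s by right; split=> // -[_ /(_ t)].
    by case: ws => [[_ H]|[]] //; apply: H.
(* Dually, a tagged node outside [D] has a child outside [D], and an untagged one has no child in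
   [D]. *)
exists PlayerII; apply: (winning_region (D := D')) => //.
- by exists r => //; apply/hD'.
- by move=> s /hD'[].
(* A terminal node labeled for player I would be tagged and hence in [D] vacuously, so the label is
   for player II. *)
- move=> s /hD'[Ts nD] ts; have [[] [Ws _]] := labels s ts => //.
  case: nD; apply/DE; split=> //; left; split; first by left.
  by move=> t /(proj2 ts).
- move=> s /hD'[Ts nD] nts mv; apply: NNPP => nex; apply: nD.
  apply/DE; split=> //; left; split.
    by right; split=> // /to_move_excl.
  move=> t st; apply: NNPP => nDt; apply: nex; exists t => //.
  by apply/hD'; split=> //; case: st.
- move=> s t /hD'[Ts nD] nmv st; apply/hD'; split; first by case: st.
  move=> Dt; apply: nD; apply/DE; split=> //; right; split; last by exists t.
  move=> [[[_ /(_ t)]] //|[_]].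
  by case: (to_move_total treeT Ts).
Qed.
End Recursion.
End GB.

Theorem theorem27 (M : structure) (HM : GBC M) :
  (ETR (@is_ordinal M) (@mem_set M) ->
   clopen_determinacy (@is_ordinal M) (@mem_set M)) /\
  (forall Gamma R : class M,
     wellorder (mem_class Gamma) (rel_of (mem_class R)) ->
     ETR (mem_class Gamma) (rel_of (mem_class R)) ->
     clopen_determinacy (mem_class Gamma) (rel_of (mem_class R))).
Proof.
by split=> [etr T W|Gamma R _ etr T W]; apply: etr_determined.
Qed.
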